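(* Let $K$ be a field and let $\mathcal{E}$ be a $\mathrm{Hom}$-finite $K$-linear exact category with enough projectives and enough injectives, let $\mathcal{P}$ be the full subcategory of projective objects and $\mathcal{I}$ the full subcategory of injective objects of $\mathcal{E}$. Let $M\in\mathcal{E}$ be an object, $\mathcal{M}=\mathrm{add}(M)$, and let $k\ge 1$. Then the following two statements are equivalent: (1) $\mathcal{P}\subset\mathrm{cogen}^k_{\mathcal{E}}(\mathcal{M})$. (2) $\mathcal{I}\subset\mathrm{gen}_k^{\mathcal{E}}(\mathcal{M})$.
   Context: Exact categories are in the sense of Quillen; a longer sequence in $\mathcal{E}$ is called exact if it is obtained by splicing short exact sequences of the exact structure. $\mathrm{Hom}$-finite means that all $\mathrm{Hom}_{\mathcal{E}}(X,Y)$ are finite-dimensional $K$-vector spaces. $\mathrm{add}(M)$ is the full subcategory of $\mathcal{E}$ of direct summands of finite direct sums of copies of $M$. For $k\ge 1$ and a full additive subcategory $\mathcal{M}\subset\mathcal{E}$: - $\mathrm{cogen}^k_{\mathcal{E}}(\mathcal{M})$ is the full subcategory of $\mathcal{E}$ of all $X$ for which there is an exact sequence $0\to X\to M_0\to\cdots\to M_k\to Z\to 0$ in $\mathcal{E}$ with $M_i\in\mathcal{M}$ for $0\le i\le k$ such that for every $N\in\mathcal{M}$ the sequence $\mathrm{Hom}_{\mathcal{E}}(M_k,N)\to\cdots\to\mathrm{Hom}_{\mathcal{E}}(M_0,N)\to\mathrm{Hom}_{\mathcal{E}}(X,N)\to 0$ of abelian groups is exact. - $\mathrm{gen}_k^{\mathcal{E}}(\mathcal{M})$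 is the full subcategory of $\mathcal{E}$ of all $X$ for which there is an exact sequence $0\to Z\to M_k\to\cdots\to M_0\to X\to 0$ in $\mathcal{E}$ with $M_i\in\mathcal{M}$ for $0\le i\le k$ such that for every $N\in\mathcal{M}$ the sequence $\mathrm{Hom}_{\mathcal{E}}(N,M_k)\to\cdots\to\mathrm{Hom}_{\mathcal{E}}(N,M_0)\to\mathrm{Hom}_{\mathcal{E}}(N,X)\to 0$ of abelian groups is exact. *)

(* Defs.v *)
From mathcomp Require Import all_boot all_order all_algebra.

Set Implicit Arguments.
Unset Strict Implicit.
Unset Printing Implicit Defensive.

Import GRing.Theory.
Local Open Scope ring_scope.

Declare Scope cat_scope.
Delimit Scope cat_scope with cat.

Record linearCategory (K : fieldType) := LinearCategory {
  obj :> Type;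
  hom : obj -> obj -> lmodType K;
  idm : forall X, hom X X;
  comp : forall X Y Z, hom Y Z -> hom X Y -> hom X Z;
  compA : forall W X Y Z (h : hom Y Z) (g : hom X Y) (f : hom W X),
    comp h (comp g f) = comp (comp h g) f;
  comp_idl : forall X Y (f : hom X Y), comp (idm Y) f = f;
  comp_idr : forall X Y (f : hom X Y), comp f (idm X) = f;
  comp_linl : forall X Y Z (f : hom X Y),
    linear (fun g : hom Y Z => comp g f);
  comp_linr : forall X Y Z (g : hom Y Z),
    linear (fun f : hom X Y => comp g f)
}.

Arguments hom {K l} X Y.
Arguments idm {K l} X.
Arguments comp {K l X Y Z} g f.

Notation "g \c f" := (comp g f) (at level 40, left associativity) : cat_scope.
Local Open Scope cat_scope.

Section LinearCategoryTheory.
Context {K : fieldType} {C : linearCategory K}.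

Definition hom_finite : Prop :=
  forall X Y : C, exists n : nat,
    exists2 v : hom X Y -> 'rV[K]_n, linear v & bijective v.

Definition is_iso (X Y : C) (f : hom X Y) : Prop :=
  exists2 g : hom Y X, g \c f = idm X & f \c g = idm Y.

Definition is_zero (O : C) : Prop :=
  forall X : C, (forall f : hom O X, f = 0) /\ (forall f : hom X O, f = 0).

Definition is_biproduct (A B S : C) : Prop :=
  exists (iA : hom A S) (iB : hom B S) (pA : hom S A) (pB : hom S B),
    [/\ pA \c iA = idm A, pB \c iB = idm B, pA \c iB = 0, pB \c iA = 0
      & iA \c pA + iB \c pB = idm S].

Definition is_copower (n : nat) (M S : C) : Prop :=
  exists (i : 'I_n -> hom M S) (p : 'I_n -> hom S M),
    (forall a b, p a \c i b = if a == b then idm M else 0) /\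
    \sum_(a < n) (i a \c p a) = idm S.

Definition additive : Prop :=
  (exists O : C, is_zero O) /\
  (forall A B : C, exists S : C, is_biproduct A B S).

Definition is_kernel (A B B' : C) (i : hom A B) (p : hom B B') : Prop :=
  p \c i = 0 /\
  forall (T : C) (f : hom T B), p \c f = 0 -> exists! g : hom T A, i \c g = f.

Definition is_cokernel (A B B' : C) (i : hom A B) (p : hom B B') : Prop :=
  p \c i = 0 /\
  forall (T : C) (f : hom B T), f \c i = 0 -> exists! g : hom B' T, g \c p = f.

(*  A --i--> B
    |f       |f'
    A' -i'-> B'   *)
Definition is_pushout (A B A' B' : C) (i : hom A B) (f : hom A A')
    (i' : hom A' B') (f' : hom B B') : Prop :=
  f' \c i = i' \c f /\
  forall (T : C) (u : hom B T) (v : hom A' T), u \c i = v \c f ->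
    exists! w : hom B' T, w \c f' = u /\ w \c i' = v.

(*  A' -p'-> B'
    |f'      |f
    A --p--> B    *)
Definition is_pullback (A B A' B' : C) (p : hom A B) (f : hom B' B)
    (p' : hom A' B') (f' : hom A' A) : Prop :=
  p \c f' = f \c p' /\
  forall (T : C) (u : hom T A) (v : hom T B'), p \c u = f \c v ->
    exists! w : hom T A', f' \c w = u /\ p' \c w = v.

(* Full subcategories are given by predicates on objects. *)
Definition in_add (M N : C) : Prop :=
  exists (n : nat) (S N' : C), is_copower n M S /\ is_biproduct N N' S.

End LinearCategoryTheory.

Arguments hom_finite {K} C.
Arguments additive {K} C.

(* Quillen's axioms, in the self-dual form given by Buehler and Keller: the
   "obscure" axiom of Quillen's original list follows from these.
   [conflation i p] says that 0 -> A --i--> B --p--> B' -> 0 is a short exact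
   sequence of the exact structure. *)
Record exactCategory (K : fieldType) := ExactCategory {
  ecat :> linearCategory K;
  ecat_additive : additive ecat;
  conflation : forall A B B' : ecat, hom A B -> hom B B' -> Prop;
  inflation := fun (A B : ecat) (i : hom A B) =>
    exists (B' : ecat) (p : hom B B'), conflation i p;
  deflation := fun (B B' : ecat) (p : hom B B') =>
    exists (A : ecat) (i : hom A B), conflation i p;
  conflation_ker : forall (A B B' : ecat) (i : hom A B) (p : hom B B'),
    conflation i p -> is_kernel i p;
  conflation_coker : forall (A B B' : ecat) (i : hom A B) (p : hom B B'),
    conflation i p -> is_cokernel i p;
  conflation_iso : forall (A B B' A1 B1 B1' : ecat)
      (i : hom A B) (p : hom B B') (i1 : hom A1 B1) (p1 : hom B1 B1')
      (a : hom A A1) (b : hom B B1) (b' : hom B' B1'),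
    is_iso a -> is_iso b -> is_iso b' ->
    b \c i = i1 \c a -> b' \c p = p1 \c b ->
    conflation i p -> conflation i1 p1;
  inflation_id : forall A : ecat, inflation (idm A);
  deflation_id : forall A : ecat, deflation (idm A);
  inflation_comp : forall (X Y Z : ecat) (g : hom Y Z) (f : hom X Y),
    inflation g -> inflation f -> inflation (g \c f);
  deflation_comp : forall (X Y Z : ecat) (g : hom Y Z) (f : hom X Y),
    deflation g -> deflation f -> deflation (g \c f);
  inflation_pushout : forall (A B A' : ecat) (i : hom A B) (f : hom A A'),
    inflation i ->
    exists (B' : ecat) (i' : hom A' B') (f' : hom B B'),
      is_pushout i f i' f' /\ inflation i';
  deflation_pullback : forall (A B B' : ecat) (p : hom A B) (f : hom B' B),
    deflation p ->
    exists (A' : ecat) (p' : hom A' B') (f' : hom A' A),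
      is_pullback p f p' f' /\ deflation p'
}.

Definition exact_at (U V W : zmodType) (f : U -> V) (g : V -> W) : Prop :=
  forall y : V, g y = 0 <-> exists x : U, f x = y.

Definition surj (U V : Type) (f : U -> V) : Prop :=
  forall y : V, exists x : U, f x = y.

Section ExactCategoryTheory.
Context {K : fieldType} {E : exactCategory K}.

Definition projective (P : E) : Prop :=
  forall (B B' : E) (p : hom B B'), deflation p ->
    surj (fun g : hom P B => p \c g).

Definition injective_obj (I : E) : Prop :=
  forall (A B : E) (i : hom A B), inflation i ->
    surj (fun g : hom B I => g \c i).

Definition enough_projectives : Prop :=
  forall X : E, exists (P : E) (p : hom P X), projective P /\ deflation p.

Definition enough_injectives : Prop :=
  forall X : E, exists (I : E) (i : hom X I), injective_obj I /\ inflation i.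

(* 0 -> X 0 -> X 1 -> ... -> X n.+1 -> 0 is obtained by splicing the n
   conflations Z i -> X i.+1 -> Z i.+1 (i < n), where Z 0 ~ X 0 and
   Z n ~ X n.+1. The entries of the families beyond this range are irrelevant. *)
Definition exact_seq (n : nat) (X : nat -> E)
    (d : forall i, hom (X i) (X i.+1)) : Prop :=
  exists (Z : nat -> E) (p : forall i, hom (X i) (Z i))
         (m : forall i, hom (Z i) (X i.+1)),
    [/\ is_iso (p 0%N), is_iso (m n),
        forall i, (i <= n)%N -> d i = m i \c p i
      & forall i, (i < n)%N -> conflation (m i) (p i.+1)].

(* The exact sequence is X 0 = A, X j.+1 = M_j for j <= k, X k.+2 = Z. *)
Definition cogen (k : nat) (MM : E -> Prop) (A : E) : Prop :=
  exists (X : nat -> E) (d : forall i, hom (X i) (X i.+1)),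
    [/\ X 0%N = A,
        exact_seq k.+1 d,
        forall j, (j <= k)%N -> MM (X j.+1)
      & forall N : E, MM N ->
          surj (fun g : hom (X 1%N) N => g \c d 0%N) /\
          forall j, (j < k)%N ->
            exact_at (fun g : hom (X j.+2) N => g \c d j.+1)
                     (fun g : hom (X j.+1) N => g \c d j)].

(* The exact sequence is X 0 = Z, X i.+1 = M_(k - i) for i <= k, X k.+2 = A. *)
Definition gen (k : nat) (MM : E -> Prop) (A : E) : Prop :=
  exists (X : nat -> E) (d : forall i, hom (X i) (X i.+1)),
    [/\ X k.+2 = A,
        exact_seq k.+1 d,
        forall i, (i <= k)%N -> MM (X i.+1)
      & forall N : E, MM N ->
          surj (fun g : hom N (X k.+1) => d k.+1 \c g) /\
          forall i, (i < k)%N ->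
            exact_at (fun g : hom N (X i.+1) => d i.+1 \c g)
                     (fun g : hom N (X i.+2) => d i.+2 \c g)].

End ExactCategoryTheory.

Arguments enough_projectives {K} E.
Arguments enough_injectives {K} E.

(* Main.v *)
From mathcomp Require Import all_boot all_order all_algebra.
From Stdlib Require Import IndefiniteDescription.

Set Implicit Arguments.
Unset Strict Implicit.
Unset Printing Implicit Defensive.

Import GRing.Theory.
Require Import Defs.
Local Open Scope ring_scope.
Local Open Scope cat_scope.

(** Splice the sequence of P from conflations Z_i -> M^i -> Z_(i+1) with
    Z_0 = P and Z_i -> M^i a left add(M)-approximation, and resolve an
    injective I = Y_0 step by step by conflations Y_(j+1) -> M_j -> Y_j with
    M_j -> Y_j a right add(M)-approximation. A dimension shift between the two
    sequences, which ends at maps Z_i -> I that extend to M^i because I is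
    injective, shows that every map P -> Y_j with j <= k factors through
    add(M). Applied to a deflation P -> Y_j from a projective, this makes the
    approximation M_j -> Y_j a deflation after adding to M_j a summand on which
    it vanishes, so the resolution can be continued. The converse is the same
    statement in the opposite category. *)

(** * Linear categories: copowers, biproducts and approximations by [add(M)] *)

Section LinearCategory.
Context {K : fieldType} {C : linearCategory K}.
Implicit Types A B X Y Z T : C.

Lemma compDl X Y Z (f : hom X Y) (g h : hom Y Z) :
  (g + h) \c f = g \c f + h \c f.
Proof. by have := comp_linl f 1 g h; rewrite !scale1r. Qed.

Lemma compDr X Y Z (g : hom Y Z) (f h : hom X Y) :
  g \c (f + h) = g \c f + g \c h.
Proof. by have := comp_linr g 1 f h; rewrite !scale1r. Qed.

Lemma comp0l X Y Z (f : hom X Y) : (0 : hom Y Z) \c f = 0.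
Proof. by apply: (addrI (0 \c f)); rewrite -compDl !addr0. Qed.

Lemma comp0r X Y Z (g : hom Y Z) : g \c (0 : hom X Y) = 0.
Proof. by apply: (addrI (g \c 0)); rewrite -compDr !addr0. Qed.

Lemma compNl X Y Z (f : hom X Y) (g : hom Y Z) : (- g) \c f = - (g \c f).
Proof. by apply: (addrI (g \c f)); rewrite -compDl !subrr comp0l. Qed.

Lemma compNr X Y Z (g : hom Y Z) (f : hom X Y) : g \c (- f) = - (g \c f).
Proof. by apply: (addrI (g \c f)); rewrite -compDr !subrr comp0r. Qed.

Lemma compZr X Y Z (g : hom Y Z) (a : K) (f : hom X Y) :
  g \c (a *: f) = a *: (g \c f).
Proof. by have := comp_linr g a f 0; rewrite comp0r !addr0. Qed.

Lemma comp_suml X Y Z (f : hom X Y) (I : finType) (g : I -> hom Y Z) :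
  (\sum_a g a) \c f = \sum_a (g a \c f).
Proof.
by apply: (big_morph (fun g => g \c f)); [exact: compDl | exact: comp0l].
Qed.

Lemma comp_sumr X Y Z (g : hom Y Z) (I : finType) (f : I -> hom X Y) :
  g \c (\sum_a f a) = \sum_a (g \c f a).
Proof.
by apply: (big_morph (fun f => g \c f)); [exact: compDr | exact: comp0r].
Qed.

Lemma is_iso_id X : is_iso (idm X).
Proof. by exists (idm X); rewrite comp_idl. Qed.

Lemma kernel_mono X Y Z (i : hom X Y) (p : hom Y Z) T (g h : hom T X) :
  is_kernel i p -> i \c g = i \c h -> g = h.
Proof.
move=> [pi0 ker] e; have [|x [_ xU]] := ker T (i \c g).
  by rewrite compA pi0 comp0l.
by rewrite -(xU g) // -(xU h).
Qed.

Lemma cokernel_epi X Y Z (i : hom X Y) (p : hom Y Z) T (g h : hom Z T) :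
  is_cokernel i p -> g \c p = h \c p -> g = h.
Proof.
move=> [pi0 coker] e; have [|x [_ xU]] := coker T (g \c p).
  by rewrite -compA pi0 comp0r.
by rewrite -(xU g) // -(xU h).
Qed.

Lemma pushout_eq A B A' B' (i : hom A B) (f : hom A A') (i' : hom A' B')
    (f' : hom B B') T (g h : hom B' T) :
  is_pushout i f i' f' -> g \c f' = h \c f' -> g \c i' = h \c i' -> g = h.
Proof.
move=> [sq po] e1 e2; have [|x [_ xU]] := po T (g \c f') (g \c i').
  by rewrite -!compA sq.
by rewrite -(xU g) // -(xU h).
Qed.

Lemma pullback_eq A B A' B' (p : hom A B) (f : hom B' B) (p' : hom A' B')
    (f' : hom A' A) T (g h : hom T A') :
  is_pullback p f p' f' -> f' \c g = f' \c h -> p' \c g = p' \c h -> g = h.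
Proof.
move=> [sq pb] e1 e2; have [|x [_ xU]] := pb T (f' \c g) (p' \c g).
  by rewrite !compA sq.
by rewrite -(xU g) // -(xU h).
Qed.

Lemma copower1 (M : C) : is_copower 1 M M.
Proof.
exists (fun=> idm M), (fun=> idm M); split=> [a b|].
  by rewrite !ord1 eqxx comp_idl.
by rewrite big_ord1 comp_idl.
Qed.

Lemma copower_add m n (M S1 S2 S : C) :
  is_copower m M S1 -> is_copower n M S2 -> is_biproduct S1 S2 S ->
  is_copower (m + n) M S.
Proof.
move=> [i1 [p1 [d1 s1]]] [i2 [p2 [d2 s2]]].
move=> [j1 [j2 [q1 [q2 [e1 e2 e12 e21 es]]]]].
exists (fun a => match split a with inl b => j1 \c i1 b | inr b => j2 \c i2 b end).
exists (fun a => match split a with inl b => p1 b \c q1 | inr b => p2 b \c q2 end).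
split=> [a b|].
  rewrite -(inj_eq (can_inj (@splitK m n))).
  case: (split a) => a'; case: (split b) => b'.
  - by rewrite -compA (compA q1) e1 comp_idl d1.
  - by rewrite -compA (compA q1) e12 comp0l comp0r.
  - by rewrite -compA (compA q2) e21 comp0l comp0r.
  - by rewrite -compA (compA q2) e2 comp_idl d2.
rewrite big_split_ord /= -es; congr (_ + _).
  rewrite -[j1 in RHS]comp_idr -s1 comp_sumr comp_suml.
  by apply: eq_bigr => a _; rewrite (unsplitK (inl a)) !compA.
rewrite -[j2 in RHS]comp_idr -s2 comp_sumr comp_suml.
by apply: eq_bigr => a _; rewrite (unsplitK (inr a)) !compA.
Qed.

Lemma copower_exists n (M : C) : additive C -> exists S : C, is_copower n M S.
Proof.
move=> [[O O0] biprod]; elim: n => [|n [S HS]].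
  exists O, (fun=> 0), (fun=> 0); split=> [[]//|].
  by rewrite big_ord0; case: (O0 O) => e _; rewrite (e (idm O)).
have [T HT] := biprod S M; exists T; rewrite -addn1.
exact: copower_add HS (copower1 M) HT.
Qed.

(** Regrouping four summands; with it the complement of a sum of two objects of [add(M)] is the sum
    of their complements, so [add(M)] is closed under biproducts. *)
Lemma biproduct_interchange (N1 N1' S1 N2 N2' S2 S N' T : C) :
  is_biproduct N1 N1' S1 -> is_biproduct N2 N2' S2 ->
  is_biproduct N1 N2 S -> is_biproduct N1' N2' N' ->
  is_biproduct S N' T -> is_biproduct S1 S2 T.
Proof.
move=> [a [a' [u [u' [ua u'a' ua' u'a aE]]]]].
move=> [b [b' [v [v' [vb v'b' vb' v'b bE]]]]].
move=> [i1 [i2 [p1 [p2 [pi1 pi2 pi12 pi21 piE]]]]].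
move=> [j1 [j2 [q1 [q2 [qj1 qj2 qj12 qj21 qjE]]]]].
move=> [k [k' [r [r' [rk rk' rkk' rk'k rE]]]]].
have rkX X (f : hom X _) : r \c (k \c f) = f by rewrite compA rk comp_idl.
have rk'X X (f : hom X _) : r' \c (k' \c f) = f by rewrite compA rk' comp_idl.
have rkk'X X (f : hom X _) : r \c (k' \c f) = 0 by rewrite compA rkk' comp0l.
have rk'kX X (f : hom X _) : r' \c (k \c f) = 0 by rewrite compA rk'k comp0l.
have pi1X X (f : hom X _) : p1 \c (i1 \c f) = f by rewrite compA pi1 comp_idl.
have pi2X X (f : hom X _) : p2 \c (i2 \c f) = f by rewrite compA pi2 comp_idl.
have pi12X X (f : hom X _) : p1 \c (i2 \c f) = 0 by rewrite compA pi12 comp0l.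
have pi21X X (f : hom X _) : p2 \c (i1 \c f) = 0 by rewrite compA pi21 comp0l.
have qj1X X (f : hom X _) : q1 \c (j1 \c f) = f by rewrite compA qj1 comp_idl.
have qj2X X (f : hom X _) : q2 \c (j2 \c f) = f by rewrite compA qj2 comp_idl.
have qj12X X (f : hom X _) : q1 \c (j2 \c f) = 0 by rewrite compA qj12 comp0l.
have qj21X X (f : hom X _) : q2 \c (j1 \c f) = 0 by rewrite compA qj21 comp0l.
have uaX X (f : hom X _) : u \c (a \c f) = f by rewrite compA ua comp_idl.
have u'a'X X (f : hom X _) : u' \c (a' \c f) = f by rewrite compA u'a' comp_idl.
have ua'X X (f : hom X _) : u \c (a' \c f) = 0 by rewrite compA ua' comp0l.
have u'aX X (f : hom X _) : u' \c (a \c f) = 0 by rewrite compA u'a comp0l.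
have vbX X (f : hom X _) : v \c (b \c f) = f by rewrite compA vb comp_idl.
have v'b'X X (f : hom X _) : v' \c (b' \c f) = f by rewrite compA v'b' comp_idl.
have vb'X X (f : hom X _) : v \c (b' \c f) = 0 by rewrite compA vb' comp0l.
have v'bX X (f : hom X _) : v' \c (b \c f) = 0 by rewrite compA v'b comp0l.
exists (k \c (i1 \c u) + k' \c (j1 \c u')).
exists (k \c (i2 \c v) + k' \c (j2 \c v')).
exists (a \c (p1 \c r) + a' \c (q1 \c r')).
exists (b \c (p2 \c r) + b' \c (q2 \c r')).
pose X0 := (comp0l, comp0r, addr0, add0r).
split; rewrite ?compDl ?compDr -!compA
  ?(rkX, rk'X, rkk'X, rk'kX, pi1X, pi2X, pi12X, pi21X, qj1X, qj2X, qj12X, qj21X, X0).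
- exact: aE.
- exact: bE.
- by [].
- by [].
rewrite !(uaX, u'a'X, ua'X, u'aX, vbX, v'b'X, vb'X, v'bX, X0).
rewrite -rE -[k in RHS]comp_idr -piE -[k' in RHS]comp_idr -qjE.
by rewrite !(compDl, compDr) -!compA addrACA.
Qed.

Lemma in_add_biproduct (M A B S : C) : additive C ->
  in_add M A -> in_add M B -> is_biproduct A B S -> in_add M S.
Proof.
move=> [_ biprod] [m [S1 [A' [cS1 bS1]]]] [n [S2 [B' [cS2 bS2]]]] bS.
have [N' bN'] := biprod A' B'; have [T bT] := biprod S N'.
exists (m + n)%N, T, N'; split=> //; apply: copower_add cS1 cS2 _.
exact: biproduct_interchange bS1 bS2 bS bN' bT.
Qed.

Definition right_approx (MM : C -> Prop) N X (g : hom N X) : Prop :=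
  forall N', MM N' -> surj (fun h : hom N' N => g \c h).

Definition left_approx (MM : C -> Prop) X N (g : hom X N) : Prop :=
  forall N', MM N' -> surj (fun h : hom N N' => h \c g).

(** A finite basis [e] of [hom M X] assembles into a map from a copower of [M] to [X]. Maps from [M]
    lift along it by their coordinates; maps from copowers, and then from their summands, follow. *)
Lemma in_add_right_approx (M X : C) : additive C -> hom_finite C ->
  exists (N : C) (g : hom N X), in_add M N /\ right_approx (in_add M) g.
Proof.
move=> addC fin; have [n [v vlin [w vK wK]]] := fin M X.
have [S cS] := copower_exists n M addC; have [i [p [d s]]] := cS.
pose e (a : 'I_n) : hom M X := w (delta_mx 0 a).
exists S, (\sum_a (e a \c p a)); split.
  have [O O0] := addC.1; exists n, S, O; split=> //.
  exists (idm S), 0, (idm S), 0.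
  by split; rewrite ?comp_idl ?comp0r ?comp0l ?addr0 //; case: (O0 O).
have gi a : (\sum_a (e a \c p a)) \c i a = e a.
  rewrite comp_suml (bigD1 a) //= -compA d eqxx comp_idr big1 ?addr0 // => b ne.
  by rewrite -compA d (negbTE ne) comp0r.
have vD x y : v (x + y) = v x + v y by have := vlin 1 x y; rewrite !scale1r.
have v0 : v 0 = 0 by apply: (addrI (v 0)); rewrite -vD !addr0.
have vZ c x : v (c *: x) = c *: v x by have := vlin c x 0; rewrite v0 !addr0.
have expand (f : hom M X) : f = \sum_a (v f 0 a *: e a).
  apply: (can_inj vK); rewrite (big_morph v vD v0) [LHS]row_sum_delta.
  by apply: eq_bigr => a _; rewrite vZ wK.
have lift (f : hom M X) : exists h, (\sum_a (e a \c p a)) \c h = f.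
  exists (\sum_a (v f 0 a *: i a)); rewrite [RHS]expand comp_sumr.
  by apply: eq_bigr => a _; rewrite compZr gi.
(* [N] is a retract of the copower [T] via [k] and [r]: the components of [f \c r] are lifted one by
   one, summed, and restricted along [k]. *)
move=> N [m [T [N' [[j [q [_ qs]]] [k [_ [r [_ [rk _ _ _ _]]]]]]]]] f.
have [h hE] := fin_all_exists (fun a => lift (f \c r \c j a)).
exists ((\sum_a (h a \c q a)) \c k) => /=.
rewrite compA comp_sumr (eq_bigr (fun a => f \c r \c (j a \c q a))).
  by rewrite -comp_sumr qs comp_idr -compA rk comp_idr.
by move=> a _; rewrite compA hE compA.
Qed.

End LinearCategory.

(** * The opposite category and its exact structure *)

Section Opposite.
Context {K : fieldType}.

Definition op_cat (C : linearCategory K) : linearCategory K :=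
  @LinearCategory K C (fun X Y => hom Y X) (fun X => idm X)
    (fun X Y Z (g : hom Z Y) (f : hom Y X) => f \c g)
    (fun W X Y Z h g f => esym (compA f g h))
    (fun X Y f => comp_idr f) (fun X Y f => comp_idl f)
    (fun X Y Z f => comp_linr f) (fun X Y Z g => comp_linl g).

Lemma op_additive (C : linearCategory K) : additive C -> additive (op_cat C).
Proof.
move=> [[O O0] biprod]; split.
  by exists O => X; have [] := O0 X.
move=> A B; have [S [i [j [p [q [e1 e2 e3 e4 e5]]]]]] := biprod A B.
by exists S, p, q, i, j.
Qed.

Lemma op_biproduct (C : linearCategory K) (A B S : C) :
  @is_biproduct K (op_cat C) A B S -> is_biproduct A B S.
Proof.
by move=> [i [j [p [q [e1 e2 e3 e4 e5]]]]]; exists p, q, i, j.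
Qed.

Lemma op_in_add (C : linearCategory K) (M N : C) :
  @in_add K (op_cat C) M N -> in_add M N.
Proof.
move=> [n [S [N' [[i [p [d s]]] bS]]]]; exists n, S, N'; split.
  exists p, i; split=> [a b|]; last exact: s.
  by have := d b a; rewrite eq_sym.
exact: op_biproduct.
Qed.

(** The double opposite has the same homs, identities and composition up to conversion, so the
    previous lemma also gives its converse. *)
Lemma in_add_op (C : linearCategory K) (M N : C) :
  in_add M N -> @in_add K (op_cat C) M N.
Proof. exact: (@op_in_add (op_cat C)). Qed.

Lemma in_add_left_approx (C : linearCategory K) (M X : C) :
  additive C -> hom_finite C ->
  exists (N : C) (g : hom X N), in_add M N /\ left_approx (in_add M) g.
Proof.
move=> addC fin.
have [|N [g [MN gP]]] := @in_add_right_approx K (op_cat C) M X (op_additive addC).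
  by move=> A B; exact: fin.
exists N, g; split; first exact: op_in_add.
by move=> N' /in_add_op; exact: gP.
Qed.

Lemma op_is_iso (C : linearCategory K) (X Y : C) (f : hom Y X) :
  @is_iso K (op_cat C) X Y f ->
  exists g : hom X Y, [/\ is_iso g, g \c f = idm Y & f \c g = idm X].
Proof. by move=> [g e1 e2]; exists g; split=> //; exists f. Qed.

(** Isomorphisms of the opposite category point the other way in [E], so the axiom of [E] is applied
    to their inverses. *)
Lemma op_conflation_iso (E : exactCategory K) (A B B' A1 B1 B1' : op_cat E)
    (i : hom A B) (p : hom B B') (i1 : hom A1 B1) (p1 : hom B1 B1')
    (a : hom A A1) (b : hom B B1) (b' : hom B' B1') :
  is_iso a -> is_iso b -> is_iso b' ->
  b \c i = i1 \c a -> b' \c p = p1 \c b ->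
  @conflation K E B' B A p i -> @conflation K E B1' B1 A1 p1 i1.
Proof.
move=> /op_is_iso[x [xi xa ax]] /op_is_iso[y [yi yb by_]] /op_is_iso[z [zi zb bz]].
move=> /= e1 e2; rewrite /= in xa ax yb by_ zb bz.
apply: (conflation_iso zi yi xi) => /=.
  by rewrite -[y \c p]comp_idr -bz compA -(compA y p) e2 compA yb comp_idl.
by rewrite -[x \c i]comp_idr -by_ compA -(compA x i) e1 compA xa comp_idl.
Qed.

Definition op_exact (E : exactCategory K) : exactCategory K :=
  @ExactCategory K (op_cat E) (op_additive (ecat_additive E))
    (fun A B B' (i : @hom K E B A) (p : @hom K E B' B) => conflation p i)
    (fun A B B' i p c => conflation_coker c)
    (fun A B B' i p c => conflation_ker c)
    (@op_conflation_iso E)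
    (fun A => deflation_id A) (fun A => inflation_id A)
    (fun X Y Z g f hg hf => deflation_comp hf hg)
    (fun X Y Z g f hg hf => inflation_comp hf hg)
    (fun A B A' i f h => deflation_pullback f h)
    (fun A B B' p f h => inflation_pushout f h).

End Opposite.

(** Choice from indefinite description; it selects the middle terms of a whole sequence of cells at
    once. *)
Lemma dependent_choice_fun (I : Type) (T : I -> Type) (P : forall i, T i -> Prop) :
  (forall i, exists x, P i x) -> exists f : forall i, T i, forall i, P i (f i).
Proof.
move=> ex; pose F i := constructive_indefinite_description _ (ex i).
by exists (fun i => sval (F i)) => i; exact: svalP (F i).
Qed.

(** * Consequences of the exact category axioms *)

Section ExactCategory.
Context {K : fieldType} {E : exactCategory K}.
Implicit Types (A B X Y Z : E) (MM : E -> Prop).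

Lemma deflation_iso X Y (f : hom X Y) : is_iso f -> deflation f.
Proof.
move=> fi; have [A [i c]] := deflation_id X; exists A, i.
apply: (conflation_iso (is_iso_id A) (is_iso_id X) fi _ _ c).
  by rewrite comp_idl comp_idr.
by [].
Qed.

(** A pushout of [i] has the same cokernel object as [i]: the comparison maps [c] and [c'] between
    [B'] and a cokernel of [i'] are mutually inverse. *)
Lemma conflation_pushout A B B' A' B1 (i : hom A B) (p : hom B B')
    (f : hom A A') (i' : hom A' B1) (f' : hom B B1) :
  conflation i p -> is_pushout i f i' f' -> inflation i' ->
  exists p' : hom B1 B', conflation i' p' /\ p' \c f' = p.
Proof.
move=> ip po [D [q iq]].
have [pi0 coker] := conflation_coker ip.
have [qi0 coker'] := conflation_coker iq.
have [|p' [[p'f p'i] _]] := po.2 _ p 0; first by rewrite comp0l pi0.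
have [c [cq _]] := coker' _ p' p'i.
have [|c' [c'p _]] := coker _ (q \c f').
  by rewrite -compA po.1 compA qi0 comp0l.
exists p'; split=> //.
apply: (conflation_iso (is_iso_id _) (is_iso_id _) (b' := c) _ _ _ iq).
- exists c'.
    apply: (cokernel_epi (conflation_coker iq)); apply: (pushout_eq po).
      by rewrite -!compA (compA c q) cq p'f c'p comp_idl.
    by rewrite -!compA qi0 !comp0r.
  apply: (cokernel_epi (conflation_coker ip)).
  by rewrite -compA c'p compA cq p'f comp_idl.
- by rewrite comp_idl comp_idr.
- by rewrite comp_idr.
Qed.

(** The cokernel of an identity is a zero object, and its conflation is transported to [O]. *)
Lemma deflation_zero : exists2 O : E, is_zero O &
  forall X, deflation (0 : hom X O).
Proof.
have [[O O0] _] := ecat_additive E; exists O => // X.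
have [B [p c]] := inflation_id X.
have p0 : p = 0 by have := (conflation_coker c).1; rewrite comp_idr.
have id0 : idm B = 0.
  by apply: (cokernel_epi (conflation_coker c)); rewrite p0 !comp0r.
exists X, (idm X).
apply: (conflation_iso (is_iso_id _) (is_iso_id _) (b' := 0) _ _ _ c) => //.
  exists 0; first by rewrite comp0l id0.
  by rewrite comp0l; case: (O0 O) => e _; rewrite (e (idm O)).
by rewrite !comp0l.
Qed.

(** The biproduct is built as the pullback of [A] and [X] over a zero object, so that its projection
    to [X] is a pulled back deflation. *)
Lemma biproduct_deflation A X :
  exists (S : E) (i : hom A S) (j : hom X S) (p : hom S A) (q : hom S X),
    [/\ p \c i = idm A, q \c j = idm X, p \c j = 0, q \c i = 0
      & i \c p + j \c q = idm S] /\ deflation q.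
Proof.
have [O O0 defl] := deflation_zero.
have [S [q [p [pb dq]]]] := deflation_pullback (0 : hom X O) (defl A).
have [|i [[pi qi] _]] := pb.2 A (idm A) 0; first by rewrite !comp0l.
have [|j [[pj qj] _]] := pb.2 X 0 (idm X); first by rewrite !comp0l.
exists S, i, j, p, q; split=> //; split=> //.
apply: (pullback_eq pb).
  by rewrite compDr !compA pi pj comp0l addr0 comp_idl comp_idr.
by rewrite compDr !compA qi qj comp0l add0r comp_idl comp_idr.
Qed.

(** Pulling [r] back along the projection of the sum of [A] and [X] yields the sum of [A] and [P],
    with deflation [s] given by identity and [r]. The row is [s], then a shear, then the projection
    [q]. *)
Lemma deflation_row A P X (g : hom A X) (r : hom P X) : deflation r ->
  exists (D : E) (i : hom A D) (j : hom P D) (p : hom D A) (q : hom D P),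
    [/\ p \c i = idm A, q \c j = idm P, p \c j = 0, q \c i = 0
      & i \c p + j \c q = idm D] /\ deflation (g \c p + r \c q).
Proof.
move=> dr.
have [S [i [j [p [q [[pi qj pj qi es] dq]]]]]] := biproduct_deflation A X.
have [D [s [t [pb ds]]]] := deflation_pullback q dr.
have [|i' [[ti si] _]] := pb.2 A 0 i; first by rewrite comp0r qi.
have [|j' [[tj sj] _]] := pb.2 P (idm P) (j \c r).
  by rewrite comp_idr compA qj comp_idl.
have sq : r \c t = q \c s := pb.1.
exists D, i', j', (p \c s), t; split.
  split=> //; first by rewrite -compA si.
    by rewrite -compA sj compA pj comp0l.
  apply: (pullback_eq pb).
    by rewrite compDr !compA ti tj !comp0l add0r comp_idl comp_idr.
  rewrite compDr !compA si sj -(compA j) sq compA -compDl es.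
  by rewrite comp_idl comp_idr.
(* The shear adding [g] of the first coordinate to the second; [j \c g \c p] squares to zero, so the
   opposite sign gives the inverse. *)
pose a := idm S + j \c g \c p.
have jgp : (j \c g \c p) \c (j \c g \c p) = 0.
  by rewrite -!compA (compA p j) pj comp0l !comp0r.
have ia : is_iso a.
  exists (idm S - j \c g \c p); rewrite /a.
    by rewrite compDl compNl comp_idl compDr comp_idr jgp addr0 addrK.
  by rewrite compDr compNr comp_idr compDl comp_idl jgp addr0 addrK.
suff -> : g \c (p \c s) + r \c t = (q \c a) \c s.
  by apply: deflation_comp ds; apply: deflation_comp dq _; exact: deflation_iso.
rewrite /a compDr comp_idr compDl !compA qj comp_idl sq addrC.
by [].
Qed.

(** * Cells, the single steps of a resolution by approximations *)

Definition rcell MM Z Y : Prop := exists (N : E) (i : hom Z N) (p : hom N Y),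
  [/\ conflation i p, MM N & right_approx MM p].

Definition lcell MM Z Y : Prop := exists (N : E) (i : hom Z N) (p : hom N Y),
  [/\ conflation i p, MM N & left_approx MM i].

(* If the category is weakly idempotent complete, g is itself a deflation. In
   general, g need not have a kernel, but (g, 0) : M0 + M' -> X has one: it is
   obtained from the kernel of (g, g h) : M0 + P -> X by pushing out along u. *)
Lemma deflation_stabilize M0 P M' X (g : hom M0 X) (h : hom P M0)
    (u : hom P M') :
  deflation (g \c h) -> inflation u ->
  exists (W L : E) (k : hom L W) (t : hom W X) (a : hom M0 W),
    [/\ is_biproduct M0 M' W, conflation k t & t \c a = g].
Proof.
move=> dgh iu.
have [D [i1 [i2 [p1 [p2 [[e1 e2 e12 e21 es] [Q [kap ct]]]]]]]] :=
  deflation_row g dgh.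
set t := _ + _ in ct.
have ti1 : t \c i1 = g.
  by rewrite compDl -!compA e1 e21 !comp0r comp_idr addr0.
have ti2 : t \c i2 = g \c h.
  by rewrite compDl -!compA e2 e12 comp0r comp_idr add0r.
(* [sig] embeds [P] into the kernel of [t]; inside [D] this copy of [P] has coordinates [h] and
   minus the identity. *)
have [|sig [sigE _]] := (conflation_ker ct).2 P (i1 \c h - i2).
  by rewrite compDr compNr compA ti1 ti2 subrr.
have [L [i' [f' [po ii']]]] := inflation_pushout sig iu.
have [W [kap' [j [po' ikap']]]] :=
  inflation_pushout i' (ex_intro _ X (ex_intro _ t ct)).
have [t' [ct' t'j]] := conflation_pushout ct po' ikap'.
(* [W] is [D] with the embedded copy of [P] replaced by [M']. The projections are defined on [D] and
   [L] separately: [v1] is [p1 + h \c p2] on [D] and kills [M'], while [v2] is [- (u \c p2)] on [D]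
   and the identity on [M']. *)
have [|w1 [[w1f w1i] _]] := po.2 M0 0 ((p1 + h \c p2) \c kap).
  rewrite comp0l -compA sigE compDl !compDr !compNr -!compA.
  rewrite (compA p1 i1) (compA p2 i1) e1 e2 e12 e21.
  by rewrite !(comp0l, comp0r, comp_idl, comp_idr) subr0 sub0r subrr.
have [|v1 [[v1j v1k] _]] := po'.2 M0 (p1 + h \c p2) w1; first by rewrite w1i.
have [|w2 [[w2f w2i] _]] := po.2 M' (idm M') ((- (u \c p2)) \c kap).
  rewrite comp_idl -compA sigE compNl compDr compNr -!compA.
  by rewrite (compA p2 i1) e2 e21 !(comp0l, comp0r, comp_idr) sub0r opprK.
have [|v2 [[v2j v2k] _]] := po'.2 M' (- (u \c p2)) w2; first by rewrite w2i.
exists W, L, kap', t', (j \c i1); split=> //; last by rewrite compA t'j ti1.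
exists (j \c i1), (kap' \c f'), v1, v2.
(* The pushout squares give [kap' \c f' \c u = j \c (i1 \c h - i2)], so the two terms containing [h]
   cancel. *)
have onj : (j \c i1 \c v1 + kap' \c f' \c v2) \c j = j.
  rewrite compDl -!compA v1j v2j compNr (compA f') po.1 compNr.
  rewrite -(compA i') (compA kap') -po'.1 -(compA j) (compA kap) sigE.
  rewrite -compNr -compDr compDr !compDl compNl opprB.
  by rewrite -compDr (compDr i1) -!compA addrACA subrr addr0 es comp_idr.
split.
- by rewrite compA v1j compDl -compA e21 comp0r addr0.
- by rewrite compA v2k.
- by rewrite compA v1k.
- by rewrite compA v2j compNl -compA e21 comp0r oppr0.
- apply: (pushout_eq po'); first by rewrite onj comp_idl.
  apply: (pushout_eq po).
    rewrite comp_idl !compDl -!compA (compA v1) v1k w1f.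
    by rewrite (compA v2) v2k w2f !comp0r comp_idr add0r.
  by rewrite comp_idl -compA -po'.1 compA onj.
Qed.

(** * The dimension shift and the construction of the resolution *)

Section Chains.
Context (MM : E -> Prop) (k : nat).

(** Induction on [j] with [i + j] fixed: [f] induces [f1] from [Z i.+1] to the preceding [Y j], and
    a factorization of [f1] yields one of [f] through the middle term of the cell at [Z i]. *)
Lemma factor_through (Z Y : nat -> E) n :
  injective_obj (Y 0%N) ->
  (forall j, (j < n)%N -> rcell MM (Y j.+1) (Y j)) ->
  (forall i, (i <= k)%N -> lcell MM (Z i) (Z i.+1)) ->
  forall j i (f : hom (Z i) (Y j)), (j <= n)%N -> (i + j <= k)%N ->
  exists (N : E) (a : hom (Z i) N) (b : hom N (Y j)), MM N /\ f = b \c a.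
Proof.
move=> injY rY lZ; elim=> [|j IHj] i f ltjn le_k.
  have [|N [a [p [c MN _]]]] := lZ i; first by rewrite addn0 in le_k.
  have [|b bE] := injY _ _ a _ f; first by exists (Z i.+1), p.
  by exists N, a, b.
have [|M1 [a [p [cap MM1 la]]]] := lZ i; first exact: leq_trans (leq_addr _ _) le_k.
have [M2 [b [q [cbq MM2 rq]]]] := rY j ltjn.
have [e eE] := la _ MM2 (b \c f).
have [|f1 [f1E _]] := (conflation_coker cap).2 _ (q \c e).
  by rewrite -compA eE compA (conflation_ker cbq).1 comp0l.
have [||N [x [y [MN f1xy]]]] := IHj i.+1 f1; first exact: ltnW.
  by rewrite addSnnS.
(* Subtracting [y' \c x \c p] makes [e] land in the kernel of [q] without changing its restriction
   along [a], since [p \c a = 0]. *)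
have [y' y'E] := rq _ MN y.
have [|s [sE _]] := (conflation_ker cbq).2 _ (e - y' \c x \c p).
  by rewrite compDr compNr !compA y'E -f1xy f1E subrr.
exists M1, a, s; split=> //; apply: (kernel_mono (conflation_ker cbq)).
rewrite compA sE compDl compNl eE -!compA (conflation_coker cap).1.
by rewrite !comp0r subr0.
Qed.

Hypothesis approxMM : forall X, exists (N : E) (g : hom N X),
  MM N /\ right_approx MM g.
Hypothesis biprodMM : forall A B S, MM A -> MM B -> is_biproduct A B S -> MM S.

(** Stated for an arbitrary class [MM] with right approximations and closed under biproducts, so
    that it also applies in the opposite category. *)
Lemma lchains_rchains :
  enough_projectives E ->
  (forall P, projective P -> exists Z : nat -> E,
     Z 0%N = P /\ forall i, (i <= k)%N -> lcell MM (Z i) (Z i.+1)) ->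
  forall I, injective_obj I -> exists Y : nat -> E,
    Y 0%N = I /\ forall j, (j <= k)%N -> rcell MM (Y j.+1) (Y j).
Proof.
move=> eproj lch I injI.
suff H n : (n <= k.+1)%N -> exists Y : nat -> E,
    Y 0%N = I /\ forall j, (j < n)%N -> rcell MM (Y j.+1) (Y j).
  exact: (H k.+1).
elim: n => [|n IHn] ltnk; first by exists (fun=> I).
have [|Y [Y0 rY]] := IHn; first exact: ltnW.
have [P [pi [projP dpi]]] := eproj (Y n).
have [Z [Z0 lZ]] := lch P projP.
case: P / Z0 pi projP dpi => pi _ dpi.
have injY : injective_obj (Y 0%N) by rewrite Y0.
have [//|//|N [a [b [MN piE]]]] := factor_through injY rY lZ (j := n) pi.
have [M0 [g [MM0 rg]]] := approxMM (Y n).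
have [b' b'E] := rg _ MN b.
(* The first cell of the chain starting at the projective supplies the inflation into [M'] needed
   for stabilizing [g]. *)
have [M' [u [v [cuv MM' _]]]] := lZ 0%N isT.
have [||W [L [x [t [y [bW cW tE]]]]]] :=
  @deflation_stabilize M0 _ M' _ g (b' \c a) u.
- by rewrite compA b'E -piE.
- by exists (Z 1%N), v.
have rL : rcell MM L (Y n).
  exists W, x, t; split=> //; first exact: biprodMM bW.
  (* Lifts along [g] become lifts along [t], because [g] is [t \c y]. *)
  move=> N' MN' f; have [f' f'E] := rg _ MN' f.
  by exists (y \c f'); rewrite compA tE.
exists (fun j => if (j <= n)%N then Y j else L); split=> // j lejn.
have [->|ne] := eqVneq j n; first by rewrite ltnn leqnn.
have ltjn : (j < n)%N by rewrite ltn_neqAle ne.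
by rewrite ltjn (ltnW ltjn); exact: rY.
Qed.

End Chains.

(* The middle terms beyond index k are filled with Z i itself, so that the
   sequence X ends with X k.+2 = Z k.+1. *)
Lemma splice k (Z : nat -> E)
    (c : forall A N B, hom A N -> hom N B -> Prop) :
  (forall i, (i <= k)%N -> exists N (a : hom (Z i) N) (b : hom N (Z i.+1)),
     c _ _ _ a b) ->
  exists (X : nat -> E) (p : forall i, hom (X i) (Z i))
    (m : forall i, hom (Z i) (X i.+1)),
    [/\ X 0%N = Z 0%N, X k.+2 = Z k.+1, is_iso (p 0%N), is_iso (m k.+1)
      & forall i, (i <= k)%N -> c _ _ _ (m i) (p i.+1)].
Proof.
move=> cell.
have Fex i : exists x : {N : E & (hom (Z i) N * hom N (Z i.+1))%type},
    if (i <= k)%N then c _ _ _ (projT2 x).1 (projT2 x).2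
    else projT1 x = Z i /\ is_iso (projT2 x).1.
  have [/cell[N [a [b cab]]]|_] := leqP i k; first by exists (existT _ N (a, b)).
  by exists (existT _ (Z i) (idm (Z i), 0)); split=> //; exact: is_iso_id.
have [x xP] := dependent_choice_fun Fex.
pose X i := if i is j.+1 then projT1 (x j) else Z 0%N.
exists X, (fun i => match i return hom (X i) (Z i) with
  | 0%N => idm (Z 0%N) | j.+1 => (projT2 (x j)).2 end).
exists (fun i => (projT2 (x i)).1).
have := xP k.+1; rewrite ltnn => -[xZ xi]; split=> //; first exact: is_iso_id.
by move=> i le_ik; have := xP i; rewrite le_ik.
Qed.

(** * Passage between chains of cells and [cogen] or [gen] *)

Lemma lchain_cogen k MM (Z : nat -> E) :
  (forall i, (i <= k)%N -> lcell MM (Z i) (Z i.+1)) -> cogen k MM (Z 0%N).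
Proof.
move=> HZ.
have [X [p [m [X0 _ ip im H]]]] := splice
  (c := fun A N B a b => [/\ conflation a b, MM N & left_approx MM a]) HZ.
exists X, (fun i => m i \c p i); split=> //.
- by exists Z, p, m; split=> // i /H[].
- by move=> j /H[].
move=> N MN; split=> [f|j ltjk y].
  have [p' p'p pp'] := ip; have [_ _ la] := H 0%N isT.
  have [g gE] := la _ MN (f \c p'); exists g.
  by rewrite compA gE -compA p'p comp_idr.
have [c1 _ _] := H j (ltnW ltjk); have [c2 _ la] := H j.+1 ltjk.
split=> [|[x <-]]; last first.
  by rewrite -!compA (compA (p j.+1)) (conflation_ker c1).1 comp0l !comp0r.
(* A map [y] killed by the differential is killed by [m j], hence factors through [p j.+1], and then
   extends along the left approximation [m j.+1]. To cancel [p j], it is an isomorphism for index 0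
   and a deflation afterwards. *)
move=> y0; have [|z [zE _]] := (conflation_coker c1).2 _ y.
  have pi0 : y \c m j \c p j = 0 by rewrite -compA.
  case: j ltjk y c1 c2 la y0 pi0 => [|j] ltjk y c1 c2 la y0 pi0.
    have [p' _ pp'] := ip.
    by rewrite -[y \c _]comp_idr -pp' compA pi0 comp0l.
  have [c0 _ _] := H j (ltnW (ltnW ltjk)).
  by apply: (cokernel_epi (conflation_coker c0)); rewrite pi0 comp0l.
have [x xE] := la _ MN z; exists x.
by rewrite compA xE zE.
Qed.

Lemma rchain_gen k MM (Z : nat -> E) :
  (forall i, (i <= k)%N -> rcell MM (Z i) (Z i.+1)) -> gen k MM (Z k.+1).
Proof.
move=> HZ.
have [X [p [m [_ Xk ip im H]]]] := splice
  (c := fun A N B a b => [/\ conflation a b, MM N & right_approx MM b]) HZ.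
exists X, (fun i => m i \c p i); split=> //.
- by exists Z, p, m; split=> // i /H[].
- by move=> j /H[].
move=> N MN; split=> [f|j ltjk y].
  have [m' m'm mm'] := im; have [_ _ ra] := H k (leqnn k).
  have [g gE] := ra _ MN (m' \c f); exists g.
  by rewrite -compA gE compA mm' comp_idl.
have [c1 _ ra] := H j (ltnW ltjk); have [c2 _ _] := H j.+1 ltjk.
split=> [|[x <-]]; last first.
  by rewrite -!compA (compA (p j.+2)) (conflation_ker c2).1 comp0l !comp0r.
move=> y0; have [|z [zE _]] := (conflation_ker c2).2 _ y.
  have mp0 : m j.+2 \c (p j.+2 \c y) = m j.+2 \c 0 by rewrite comp0r compA.
  (* [m j.+2] can be cancelled: it is an isomorphism at the right end [j.+1 = k] and an inflation
     before it. *)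
  move: ltjk; rewrite leq_eqVlt => /orP[/eqP ejk|ltjk].
    have [m' m'm _] : is_iso (m j.+2) by rewrite ejk.
    by rewrite -[_ \c y]comp_idl -m'm -compA mp0 comp0r comp0r.
  have [c3 _ _] := H j.+2 ltjk.
  exact: (kernel_mono (conflation_ker c3)) mp0.
have [x xE] := ra _ MN z; exists x.
by rewrite -compA xE zE.
Qed.

Lemma cogen_lchain k MM A : cogen k MM A -> exists Z : nat -> E,
  Z 0%N = A /\ forall i, (i <= k)%N -> lcell MM (Z i) (Z i.+1).
Proof.
move=> [X [d [<- [Z [p [m [ip im dE H]]]] MX ex]]].
(* [Z 0] is only isomorphic to the given object, so [X 0] takes its place. *)
exists (fun i => if i is j.+1 then Z j.+1 else X 0%N); split=> // -[|j] le_jk.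
  have [p' p'p pp'] := ip.
  exists (X 1%N), (d 0%N), (p 1%N); split; [|exact: MX|].
    apply: (conflation_iso (a := p') _ (is_iso_id _) (is_iso_id _) _ _ (H 0%N isT)).
    - by exists (p 0%N).
    - by rewrite dE // comp_idl -compA pp' comp_idr.
    - by rewrite comp_idl comp_idr.
  by move=> N /ex[].
exists (X j.+2), (m j.+1), (p j.+2); split; [exact: H|exact: MX|].
move=> N /ex[_ /(_ j le_jk) exj] f; have c := H j (ltnW le_jk : (j < k.+1)%N).
(* To extend [f] along [m j.+1], it is first pulled back along [p j.+1]; exactness extends the
   result along [d j.+1], and the epimorphism [p j.+1] is then cancelled. *)
have [x xE] : exists x : hom (X j.+2) N, x \c d j.+1 = f \c p j.+1.
  apply: (exj (f \c p j.+1)).1; rewrite dE ?(leqW (ltnW le_jk)) //.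
  by rewrite -compA (compA (p j.+1)) (conflation_ker c).1 comp0l comp0r.
exists x; apply: (cokernel_epi (conflation_coker c)).
by rewrite -xE dE ?compA // leqW.
Qed.

Lemma gen_rchain k MM A : gen k MM A -> exists Z : nat -> E,
  Z k.+1 = A /\ forall i, (i <= k)%N -> rcell MM (Z i) (Z i.+1).
Proof.
move=> [X [d [<- [Z [p [m [ip im dE H]]]] MX ex]]].
(* Here the last term [Z k.+1] is only isomorphic to the given object and is replaced by
   [X k.+2]. *)
exists (fun i => if (i <= k)%N then Z i else X k.+2); rewrite ltnn; split=> // i.
move=> le_ik; rewrite le_ik; move: (le_ik); rewrite leq_eqVlt.
case/orP=> [/eqP eik|ltik].
  move: eik => ->; rewrite ltnn.
  exists (X k.+1), (m k), (d k.+1); split; [|exact: MX|].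
    apply: (conflation_iso (is_iso_id _) (is_iso_id _) im _ _ (H k _)) => //.
    - by rewrite comp_idl comp_idr.
    - by rewrite dE // comp_idr.
  by move=> N /ex[].
rewrite ltik; exists (X i.+1), (m i), (p i.+1); split; [exact: H|exact: MX|].
move=> N /ex[_ /(_ i ltik) exi] f; have c := H i.+1 (ltik : (i.+1 < k.+1)%N).
have [x xE] : exists x : hom N (X i.+1), d i.+1 \c x = m i.+1 \c f.
  apply: (exi (m i.+1 \c f)).1; rewrite dE //.
  by rewrite -compA (compA (p i.+2)) (conflation_ker c).1 comp0l comp0r.
exists x; apply: (kernel_mono (conflation_ker c)).
by rewrite -xE dE ?compA // leqW.
Qed.

End ExactCategory.

(** * Duality of cells and the equivalence *)

Lemma op_lcell (K : fieldType) (E : exactCategory K) (MM : E -> Prop) (Z Y : E) :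
  @lcell K (op_exact E) MM Z Y <-> rcell MM Y Z.
Proof.
by split=> -[N [i [p [c MN ap]]]]; exists N, p, i.
Qed.

Lemma op_rcell (K : fieldType) (E : exactCategory K) (MM : E -> Prop) (Z Y : E) :
  @rcell K (op_exact E) MM Z Y <-> lcell MM Y Z.
Proof.
by split=> -[N [i [p [c MN ap]]]]; exists N, p, i.
Qed.

Theorem mainTheorem3 (K : fieldType) (E : exactCategory K)
    (hfin : hom_finite E)
    (hproj : enough_projectives E) (hinj : enough_injectives E)
    (M : E) (k : nat) (hk : (1 <= k)%N) :
  (forall P : E, projective P -> cogen k (in_add M) P) <->
  (forall I : E, injective_obj I -> gen k (in_add M) I).
Proof.
have addE := ecat_additive E.
split=> H.
  move=> I injI.
  have [||//|P projP|Y [Y0 rY]] := @lchains_rchains K E (in_add M) k _ _ _ _ I injI.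
  - by move=> X; exact: in_add_right_approx.
  - by move=> A B S; exact: in_add_biproduct.
  - by have [Z ZP] := cogen_lchain (H P projP); exists Z.
  (* [Y] starts at [I], whereas the chain for [gen] ends there, so the indices are reversed by
     [k.+1 - i]. *)
  rewrite -Y0 -(subnn k.+1); apply: (rchain_gen (Z := fun i => Y (k.+1 - i)%N)).
  by move=> i le_ik; rewrite subSS subSn //; apply: rY; exact: leq_subr.
move=> P projP.
(* In the opposite category [P] is injective, and right approximations there are left approximations
   in [E]. *)
have [|||I injI|Y [Y0 rY]] :=
  @lchains_rchains K (op_exact E) (@in_add K E M) k _ _ _ _ P (fun A B => projP B A).
- by move=> X; exact: (in_add_left_approx M X addE hfin).
- by move=> A B S MA MB /op_biproduct; exact: in_add_biproduct.
- move=> X; have [I [i [injI infl]]] := hinj X.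
  by exists I, i; split=> // B B' p; exact: injI.
- have [Z [ZI rZ]] := gen_rchain (H I (fun A B => injI B A)).
  exists (fun i => Z (k.+1 - i)%N); split; first by rewrite subn0.
  move=> i le_ik; apply/op_lcell; rewrite subSS subSn //.
  by apply: rZ; exact: leq_subr.
rewrite -Y0; apply: lchain_cogen => i le_ik; apply/op_rcell; exact: rY.
Qed.
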